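(* Let $\Omega$ be an $n\times n$ matrix-valued measure on $\mathbb{R}$ such that $\int_{\mathbb{R}}\frac{d\Omega(y)}{1+y^{2}}\in\mathbb{C}^{n\times n}$. For $x\in\mathbb{R}$ let $T(x):=\int_{\mathbb{R}}\frac{d\Omega(y)}{(x-y)^{2}}$. Then the set $$\{x\in\operatorname{supp}\Omega : T(x)\notin\mathbb{C}^{n\times n}\}$$ is a dense $G_{\delta}$ subset of $\operatorname{supp}\Omega$ (with the relative topology).
   Context: A matrix-valued measure is a map $\Omega$ from the Borel sets of $\mathbb{R}$ to $\mathbb{C}^{n\times n}$ such that $\Omega(X)$ is positive semidefinite for each bounded Borel $X$, $\Omega(\varnothing)=0$, and $\Omega$ is countably additive on disjoint families with bounded union; $\operatorname{supp}\Omega$ is its (closed) support, i.e. the support of the trace measure $\operatorname{Tr}\Omega=\sum_i\langle e_i,\Omega(\cdot)e_i\rangle$. For a Borel function $f$, $\int_{\mathbb{R}}f\,d\Omega$ denotes the matrix associated with the sesquilinear form $(a,b)\mapsto\int_{\mathbb{R}}f(y)\,d\langle a,\Omega(y)b\rangle_{\mathbb{C}^n}$; $\int f\,d\Omega\in\mathbb{C}^{n\times n}$ means this form is defined (finite) for all $a,b\in\mathbb{C}^n$. Thus $T(x)\in\mathbb{C}^{n\times n}$ iff $\int\frac{1}{(x-y)^2}d\langle c,\Omega(y)c\rangle<\infty$ for all $c\in\mathbb{C}^n$. *)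

(* Defs.v *)
From HB Require Import structures.
From mathcomp Require Import all_boot all_order all_algebra.
From mathcomp Require Import all_classical all_reals all_analysis.
From mathcomp Require Import complex.

Set Implicit Arguments.
Unset Strict Implicit.
Unset Printing Implicit Defensive.

Import Order.TTheory GRing.Theory Num.Theory.
Import numFieldNormedType.Exports.
Local Open Scope classical_set_scope.
Local Open Scope ring_scope.

Section MatrixMeasure.
Context {R : realType} {n : nat}.

Definition qform (A : 'M[R[i]]_n) (c : 'cV[R[i]]_n) : R[i] :=
  ((map_mx Num.conj c)^T *m A *m c) 0 0.

(* positive semidefinite (over C: <c,Ac> is real and >= 0 for all c) *)
Definition psd (A : 'M[R[i]]_n) : Prop := forall c, 0 <= qform A c.

Definition bounded_set (X : set R) : Prop :=
  exists M : R, X `<=` `[- M, M].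

Definition matrix_measure (Om : set R -> 'M[R[i]]_n) : Prop :=
  [/\ (forall X, measurable X -> bounded_set X -> psd (Om X)),
      Om set0 = 0 &
      (forall F : (set R)^nat,
         (forall k, measurable (F k)) -> trivIset setT F ->
         bounded_set (\bigcup_k F k) ->
         forall i j,
           (fun N => complex.Re ((\sum_(k < N) Om (F k)) i j)) @ \oo -->
             complex.Re (Om (\bigcup_k F k) i j) /\
           (fun N => complex.Im ((\sum_(k < N) Om (F k)) i j)) @ \oo -->
             complex.Im (Om (\bigcup_k F k) i j))].

(* the positive (locally finite) scalar measure X |-> <c, Om(X) c>,
   extended to all Borel sets by monotone exhaustion with [-k,k] *)
Definition qmeasure (Om : set R -> 'M[R[i]]_n) (c : 'cV[R[i]]_n)
  : set R -> \bar R :=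
  fun X => ereal_sup
    [set (complex.Re (qform (Om (X `&` `[- (k%:R), k%:R])) c))%:E | k in [set: nat]].

(* \int f dOm is a (finite) matrix, for f >= 0:
   int f d<c,Om c> < oo for every c in C^n *)
Definition mx_integral_finite (Om : set R -> 'M[R[i]]_n) (f : R -> \bar R)
  : Prop :=
  forall c : 'cV[R[i]]_n, (\int[qmeasure Om c]_(y in [set: R]) f y < +oo)%E.

Definition mx_supp (Om : set R -> 'M[R[i]]_n) : set R :=
  [set x | forall e : R, 0 < e -> \tr (Om [set` `]x - e, x + e[]) != 0].

End MatrixMeasure.

Definition Tkernel {R : realType} (x y : R) : \bar R :=
  if y == x then +oo%E else ((x - y) ^- 2)%:E.

Definition Pkernel {R : realType} (y : R) : \bar R :=
  ((1 + y ^+ 2)^-1)%:E.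

(* Main.v *)
(* G_delta: by Fatou's lemma each [x |-> int (x - y)^-2 d<e_i, Om(y) e_i>] is
   lower semicontinuous, and [T x] is finite iff these [n] integrals are, since
   <u + v, A (u + v)> <= 2 (<u, A u> + <v, A v>) for positive semidefinite [A].

   Density: near a point of the support some scalar measure
   [mu = <e_i, Om e_i>] charges a small interval [J].  Bisect [J], keeping the
   heavier half each time.  The intervals shrink to a point [z] with
   mu(J_k) >= mu(J) / 2^k and |J_k| = |J| / 2^k; hence [z] is in the support,
   and the integral over [J_k] of (z - y)^-2 is at least
   2^k mu(J) / |J|^2, which is unbounded in [k]. *)
Require Import Defs.
From HB Require Import structures.
From mathcomp Require Import all_boot all_order all_algebra.
From mathcomp Require Import all_classical all_reals all_analysis.
From mathcomp Require Import measurable_realfun.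
From mathcomp Require Import complex.
From mathcomp Require Import ring lra.
Import Order.TTheory GRing.Theory Num.Theory.
Import numFieldNormedType.Exports.
Local Open Scope classical_set_scope.
Local Open Scope ring_scope.

(** * Quadratic forms of complex matrices and their real parts *)

Section QuadraticForm.
Context {R : realType} {n : nat}.
Implicit Types (A B : 'M[R[i]]_n) (c u v : 'cV[R[i]]_n).

Definition reqform A c : R := complex.Re (qform A c).

Lemma qformE A c :
  qform A c = \sum_i \sum_j Num.conj (c i 0) * c j 0 * A i j.
Proof.
rewrite /qform mxE exchange_big /=; apply: eq_bigr => j _.
rewrite mxE mulr_suml; apply: eq_bigr => i _.
by rewrite !mxE mulrAC.
Qed.

Lemma qform0 c : qform 0 c = 0.
Proof. by rewrite /qform mulmx0 mul0mx mxE. Qed.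

Lemma qformD A B c : qform (A + B) c = qform A c + qform B c.
Proof. by rewrite /qform mulmxDr mulmxDl mxE. Qed.

Lemma qform_sum (I : Type) (r : seq I) (F : I -> 'M[R[i]]_n) c :
  qform (\sum_(k <- r) F k) c = \sum_(k <- r) qform (F k) c.
Proof. exact: (big_morph (qform^~ c) (fun A B => qformD A B c) (qform0 c)). Qed.

Lemma qformZ A (a : R[i]) c : qform A (a *: c) = `|a| ^+ 2 * qform A c.
Proof.
rewrite !qformE mulr_sumr; apply: eq_bigr => i _.
rewrite mulr_sumr; apply: eq_bigr => j _.
by rewrite !mxE rmorphM /= normCK; ring.
Qed.

Lemma qform_parallelogram A u v :
  qform A (u + v) + qform A (u - v) = (qform A u + qform A v) *+ 2.
Proof.
rewrite !qformE -!big_split -sumrMnl; apply: eq_bigr => i _ /=.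
rewrite -!big_split -sumrMnl; apply: eq_bigr => j _ /=.
by rewrite !mxE rmorphD rmorphB /=; ring.
Qed.

Lemma qform_delta A i : qform A (delta_mx i 0) = A i i.
Proof.
rewrite qformE (bigD1 i) //= (bigD1 i) //= !mxE !eqxx /= conjC1 !mul1r.
rewrite !big1 ?addr0 // => j /negPf ji.
  by rewrite big1 // => k _; rewrite !mxE ji conjC0 !mul0r.
by rewrite !mxE ji mulr0 mul0r.
Qed.

Lemma ReD (x y : R[i]) : complex.Re (x + y) = complex.Re x + complex.Re y.
Proof. by case: x y => [? ?] [? ?]. Qed.

Lemma ReM (x y : R[i]) : complex.Re (x * y) =
  complex.Re x * complex.Re y - complex.Im x * complex.Im y.
Proof. by case: x y => [? ?] [? ?]. Qed.

Lemma Re_ge0 (x : R[i]) : 0 <= x -> 0 <= complex.Re x.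
Proof. by rewrite lecE => /andP[]. Qed.

Lemma Re_sum (I : Type) (r : seq I) (F : I -> R[i]) :
  complex.Re (\sum_(k <- r) F k) = \sum_(k <- r) complex.Re (F k).
Proof. exact: (big_morph (@complex.Re R) ReD). Qed.

Lemma reqform_ge0 A c : psd A -> 0 <= reqform A c.
Proof. by move=> /(_ c) /Re_ge0. Qed.

(** The parallelogram identity, from which the term at [u - v] is dropped because positivity makes
    it nonnegative. *)
Lemma reqformD_le A u v : psd A ->
  reqform A (u + v) <= 2 * (reqform A u + reqform A v).
Proof.
move=> pA; have /(congr1 (@complex.Re R)) := qform_parallelogram A u v.
rewrite mulr2n !ReD -!/(reqform _ _); have := reqform_ge0 A (u - v) pA; lra.
Qed.

Lemma reqformZ A (a : R[i]) c :
  reqform A (a *: c) = (complex.Re `|a|) ^+ 2 * reqform A c.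
Proof.
have rea : `|a| = (complex.Re `|a|)%:C%C by rewrite RRe_real// normr_real.
by rewrite /reqform qformZ rea -rmorphXn ReM [complex.Im _]/= mul0r subr0.
Qed.

(** This carries the entrywise countable additivity of [matrix_measure] over to the scalar set
    functions: the form is a finite sum of real and imaginary parts of entries with fixed
    coefficients. *)
Lemma cvg_reqform (F : nat -> 'M[R[i]]_n) A c :
  (forall i j, (fun N => complex.Re (F N i j)) @ \oo --> complex.Re (A i j) /\
               (fun N => complex.Im (F N i j)) @ \oo --> complex.Im (A i j)) ->
  (fun N => reqform (F N) c) @ \oo --> reqform A c.
Proof.
move=> FA; rewrite /reqform qformE Re_sum.
under eq_fun do rewrite qformE Re_sum.
apply: cvg_big => [|i _]; first exact: add_continuous.
rewrite Re_sum; under eq_fun do rewrite Re_sum.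
apply: cvg_big => [|j _]; first exact: add_continuous.
rewrite ReM; under eq_fun do rewrite ReM.
have [? ?] := FA i j.
by apply: cvgB; apply: cvgM => //; exact: cvg_cst.
Qed.

End QuadraticForm.

(** * The scalar measures attached to a matrix-valued measure *)

Section ScalarMeasure.
Context {R : realType} {n : nat}.
Variable Om : set R -> 'M[R[i]]_n.
Hypothesis Om_measure : matrix_measure Om.
Implicit Types (X Y : set R) (c : 'cV[R[i]]_n).

(* Unqualified, [bounded_set] is the homonymous notion of MathComp-Analysis. *)
Lemma bounded_setS X Y : X `<=` Y -> Defs.bounded_set Y -> Defs.bounded_set X.
Proof. by move=> XY [M YM]; exists M => x /XY /YM. Qed.

Lemma bounded_itv (M : R) : Defs.bounded_set `[- M, M].
Proof. by exists M. Qed.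

Lemma bounded_setU X Y :
  Defs.bounded_set X -> Defs.bounded_set Y -> Defs.bounded_set (X `|` Y).
Proof.
move=> [M XM] [N YN]; exists (Num.max M N) => x [/XM|/YN] /=;
  rewrite !in_itv /= => /andP[lx ux]; apply/andP; split.
- by rewrite (le_trans _ lx) // lerN2 le_max lexx.
- by rewrite (le_trans ux) // le_max lexx.
- by rewrite (le_trans _ lx) // lerN2 le_max lexx orbT.
- by rewrite (le_trans ux) // le_max lexx orbT.
Qed.

Lemma bounded_itv_exhaust X :
  Defs.bounded_set X -> exists k : nat, X `<=` `[- k%:R, k%:R].
Proof.
move=> [M XM]; exists (Num.truncn `|M|).+1 => x /XM /=.
rewrite !in_itv /= => /andP[lx ux].
have := truncnS_gt `|M|; have := ler_norm M.
by move=> ? ?; apply/andP; split; lra.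
Qed.

(* Extending by [0] outside the measurable sets: a measure of the library must
   be nonnegative on all sets, whereas [Om] is arbitrary on nonmeasurable ones. *)
Lemma restricted_measure B c : measurable B -> Defs.bounded_set B ->
  exists mu : {measure set R -> \bar R},
    forall X, measurable X -> mu X = (reqform (Om (X `&` B)) c)%:E.
Proof.
move=> mB bB; have [Om_psd Om0 Om_sigma] := Om_measure.
pose rho (X : set R) : \bar R :=
  if `[< measurable X >] then (reqform (Om (X `&` B)) c)%:E else 0%E.
have rhoE X : measurable X -> rho X = (reqform (Om (X `&` B)) c)%:E.
  by move=> mX; rewrite /rho; case: asboolP.
have rho0 : rho set0 = 0%E.
  by rewrite rhoE // set0I Om0 /reqform qform0.
have rho_ge0 X : (0 <= rho X)%E.
  rewrite /rho; case: asboolP => // mX; rewrite lee_fin reqform_ge0 //.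
  by apply: Om_psd; [exact: measurableI | exact: bounded_setS bB].
have rho_sigma : semi_sigma_additive rho.
  move=> F mF tF mUF; rewrite rhoE // setI_bigcupl.
  have -> : (fun N => \sum_(0 <= i < N) rho (F i))%E =
      EFin \o (fun N => reqform (\sum_(k < N) Om (F k `&` B)) c).
    apply/funext => N /=; rewrite big_mkord /reqform qform_sum Re_sum -sumEFin.
    by apply: eq_bigr => i _; rewrite rhoE.
  apply: cvg_EFin; first exact: nearW.
  apply: (cvg_reqform (fun N => \sum_(k < N) Om (F k `&` B))) => i j.
  apply: (Om_sigma (fun k => F k `&` B)).
  - by move=> k; exact: measurableI.
  - exact: trivIset_setIr.
  - by apply: bounded_setS bB; rewrite -setI_bigcupl.
exists (HB.pack_for {measure set R -> \bar R} rho
  (isMeasure.Build _ _ _ rho rho0 rho_ge0 rho_sigma)).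
exact: rhoE.
Qed.

Lemma reqform_setU X Y c : measurable X -> measurable Y -> Defs.bounded_set X ->
  Defs.bounded_set Y -> X `&` Y = set0 ->
  reqform (Om (X `|` Y)) c = reqform (Om X) c + reqform (Om Y) c.
Proof.
move=> mX mY bX bY XY0; have mXY := measurableU _ _ mX mY.
have [mu muE] := restricted_measure _ c mXY (bounded_setU _ _ bX bY).
have : mu (X `|` Y) = (mu X + mu Y)%E by exact: measureU.
rewrite (muE _ mXY) (muE _ mX) (muE _ mY) setIid.
rewrite (setIidl (@subsetUl _ X Y)) (setIidl (@subsetUr _ X Y)).
by rewrite -EFinD => -[].
Qed.

Lemma reqform_le X Y c : measurable X -> measurable Y -> Defs.bounded_set Y ->
  X `<=` Y -> reqform (Om X) c <= reqform (Om Y) c.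
Proof.
move=> mX mY bY XY; have [mu muE] := restricted_measure _ c mY bY.
rewrite -lee_fin; have : (mu X <= mu Y)%E by apply: le_measure; rewrite ?inE.
by rewrite (muE _ mX) (muE _ mY) setIid (setIidl XY).
Qed.

(** By monotonicity no truncation exceeds the full value, and the supremum is attained once [[-k,k]]
    contains [X]. *)
Lemma qmeasure_bounded X c : measurable X -> Defs.bounded_set X ->
  qmeasure Om c X = (reqform (Om X) c)%:E.
Proof.
move=> mX bX; apply/eqP; rewrite eq_le; apply/andP; split.
  apply: ge_ereal_sup => _ [k _ <-]; rewrite lee_fin.
  by apply: reqform_le => //; exact: measurableI.
have [k Xk] := bounded_itv_exhaust _ bX.
apply: ereal_sup_ubound; exists k; first by [].
rewrite /reqform.
by congr (complex.Re (qform (Om _) c))%:E; exact/setIidl.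
Qed.

(* [Om] is additive only along bounded unions, so the exhaustion by [-k,k] is
   cut into disjoint annuli and the measure is the sum of its restrictions. *)
Lemma qmeasure_measure c : exists mu : {measure set R -> \bar R},
  forall X, measurable X -> qmeasure Om c X = mu X.
Proof.
pose I (k : nat) : set R := [set` `[- k%:R, k%:R]].
have mI k : measurable (I k) by exact: measurable_itv.
have ndI : nondecreasing_seq I.
  move=> j k jk; apply/subsetPset => x; rewrite /I /= !in_itv /= => /andP[lx ux].
  have : j%:R <= k%:R :> R by rewrite ler_nat.
  by move=> ?; apply/andP; split; lra.
have mD k : measurable (seqD I k) by case: k => [|k] //=; exact: measurableD.
have bD k : Defs.bounded_set (seqD I k).
  apply: (bounded_setS _ (I k)); last exact: bounded_itv.
  by case: k => [|k] //=; exact: subDsetl.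
have [m mE] := choice (fun k => restricted_measure _ c (mD k) (bD k)).
exists (mseries m 0) => X mX.
pose q k := (reqform (Om (X `&` I k)) c)%:E.
(* The annuli up to index [k] partition [I k], so the partial sums telescope to the truncations
   defining [qmeasure]. *)
have sumE k : (\sum_(0 <= j < k.+1) m j X)%E = q k.
  elim: k => [|k IH]; first by rewrite big_nat1 mE.
  rewrite (big_nat_recr _ _ _ (leq0n k.+1)) [LHS]/= IH (mE k.+1 X mX) -EFinD.
  rewrite /q (setU_seqD ndI) setIUr.
  rewrite reqform_setU //.
  - exact: measurableI.
  - exact: measurableI.
  - exact: bounded_setS (@subIsetr _ _ _) (bounded_itv _).
  - exact: bounded_setS (@subIsetr _ _ _) (bD k.+1).
  - by apply/seteqP; split => // x [[_ Ikx] [_ []]].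
have ndq : nondecreasing_seq q.
  move=> j k jk; rewrite lee_fin; apply: reqform_le; try exact: measurableI.
    exact: bounded_setS (@subIsetr _ _ _) (bounded_itv _).
  by apply: setIS; apply/subsetPset/ndI.
apply/esym; rewrite /mseries; apply/cvg_lim => //.
(* The shift skips the empty partial sum, since [sumE] describes sums of [k.+1] terms. *)
rewrite -cvg_shiftS /=; under eq_fun do rewrite sumE.
exact: ereal_nondecreasing_cvgn.
Qed.

End ScalarMeasure.

(** * Continuity of the kernel and semicontinuity of its integral *)

Section SingularIntegral.
Context {R : realType}.
Variable mu : {measure set R -> \bar R}.
Implicit Types x y z : R.

Lemma Tkernel_ge0 x y : (0 <= Tkernel x y)%E.
Proof. by rewrite /Tkernel; case: ifP => // _; rewrite lee_fin invr_ge0 sqr_ge0. Qed.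

(** The value [+oo] on the diagonal is the limit of the inverse square there, so the kernel is
    continuous into the extended reals even at [x = y]. *)
Lemma cvg_Tkernel {T : Type} {F : set_system T} {FF : Filter F}
  (x_ : T -> R) x y : x_ @ F --> x -> Tkernel (x_ m) y @[m --> F] --> Tkernel x y.
Proof.
move=> x_x; rewrite /Tkernel; case: eqVneq => [->|yx].
  apply/cvgeyPge => A; near=> m.
  case: eqVneq => [_|xm]; first by rewrite leey.
  (* The threshold [A] may be nonpositive; [|A| + 1] is a larger positive one, whose inverse bounds
     the squared distance. *)
  rewrite lee_fin; have A0 : 0 < `|A| + 1 by rewrite ltr_wpDl.
  have xm0 : 0 < (x_ m - x) ^+ 2 by rewrite exprn_even_gt0 //= subr_eq0 eq_sym.
  have AA : A <= `|A| + 1 by have := ler_norm A; lra.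
  apply: (le_trans AA); rewrite -(invrK (`|A| + 1)).
  rewrite lef_pV2 ?posrE ?invr_gt0 //.
  have : `|x - x_ m| < Num.sqrt (`|A| + 1)^-1.
    by near: m; move/cvgrPdist_lt: x_x; apply; rewrite sqrtr_gt0 invr_gt0.
  rewrite distrC -sqrtr_sqr ltr_sqrt ?invr_gt0 //; exact: ltW.
have xy0 : x - y != 0 by rewrite subr_eq0 eq_sym.
(* Off the diagonal [x_ m] eventually differs from [y], so the kernel is given by its finite
   formula. *)
apply: (@cvg_trans _ (((x_ m - y) ^- 2)%:E @[m --> F])).
  apply: near_eq_cvg; near=> m.
  suff /negPf -> : y != x_ m by [].
  rewrite eq_sym -subr_eq0; near: m.
  apply: (cvgr_neq0 (x - y)) => //; apply: cvgB => //; exact: cvg_cst.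
apply: cvg_EFin; first exact: nearW.
apply: cvgV; first by rewrite expf_neq0.
rewrite expr2; under eq_cvg do rewrite expr2.
by apply: cvgM; apply: cvgB => //; exact: cvg_cst.
Unshelve. all: by end_near. Qed.

Lemma TkernelC x y : Tkernel x y = Tkernel y x.
Proof. by rewrite /Tkernel eq_sym -opprB sqrrN. Qed.

Lemma measurable_Tkernel x : measurable_fun [set: R] (Tkernel x).
Proof.
apply: lower_semicontinuous_measurable; apply/lower_semicontinuousP => a.
have /continuousP opT : continuous (Tkernel x).
  move=> y; have -> : Tkernel x = Tkernel^~ x by apply/funext => z; exact: TkernelC.
  by apply: (cvg_Tkernel id).
by have := opT _ (@open_ereal_gt_ereal R a%:E); rewrite /preimage.
Qed.

Lemma lower_semicontinuous_integral_Tkernel :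
  lower_semicontinuous (fun x => \int[mu]_(y in [set: R]) Tkernel x y)%E.
Proof.
move=> x a ax; apply: contrapT => /forall2NP noV.
(* If semicontinuity fails at [x], every ball around [x] contains a point where the integral is at
   most [a]; shrinking radii yield a sequence tending to [x]. *)
have /choice[x_ x_P] (m : nat) : exists z, ball x m.+1%:R^-1 z /\
    (\int[mu]_(y in [set: R]) Tkernel z y <= a%:E)%E.
  have [//|/existsNP[z /not_implyP[zx /negP za]]] := noV (ball x m.+1%:R^-1).
    by case; apply: nbhsx_ballx; rewrite invr_gt0.
  by exists z; split=> //; rewrite leNgt.
have x_x : x_ @ \oo --> x.
  apply/cvgrPdist_lt => e e0; near=> m.
  have [/lt_trans + _] := x_P m; apply; near: m.
  exact: (near_infty_natSinv_lt (PosNum e0)).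
have := fatou mu measurableT (fun m => measurable_Tkernel (x_ m))
  (fun m y _ => Tkernel_ge0 (x_ m) y).
(* Continuity of the kernel identifies the lower limit inside the integral with [Tkernel x]. *)
under eq_integral do rewrite (cvg_limn_einf_sup (cvg_Tkernel _ _ _ x_x)).1.
move=> /(lt_le_trans ax); apply/negP; rewrite -leNgt limn_einf_lim.
apply: lime_le; first exact: is_cvg_einfs.
apply: nearW => m; apply: le_trans (x_P m).2.
by apply: ereal_inf_lbound; exists m => /=.
Unshelve. all: by end_near. Qed.

End SingularIntegral.

(** * Bisection towards a point with infinite singular integral *)

Section Bisection.
Context {R : realType}.
Variable mu : {measure set R -> \bar R}.

Definition heavy_half (I : R * R) : R * R :=
  let m := (I.1 + I.2) / 2 in
  if (mu `[m, I.2]%classic <= mu `[I.1, m]%classic)%E then (I.1, m) else (m, I.2).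

(** The closed halves share the midpoint, so subadditivity is used: if the heavier half were below
    [t / 2], so would be the lighter one, and together they could not reach [t]. *)
Lemma heavy_half_measure (I : R * R) (t : R) :
  I.1 <= I.2 -> (t%:E <= mu `[I.1, I.2]%classic)%E ->
  ((t / 2)%:E <= mu `[(heavy_half I).1, (heavy_half I).2]%classic)%E.
Proof.
case: I => a b /= ab tI; rewrite /heavy_half /=; set m := (a + b) / 2.
have {}tI : (t%:E <= mu `[a, m]%classic + mu `[m, b]%classic)%E.
  apply: (le_trans tI).
  apply: (@le_trans _ _ (mu (`[a, m]%classic `|` `[m, b]%classic))).
    apply: le_measure; rewrite ?inE //; first exact: measurableU.
    move=> x; rewrite /= !in_itv /= => /andP[ax xb].
    by have [xm|/ltW mx] := leP x m; [left|right]; apply/andP.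
  exact: measureU2.
case: ifP => [le_rl|/negbT]; last rewrite -ltNge => lt_lr.
  rewrite leNgt; apply/negP => /= ht; move: tI; apply/negP; rewrite -ltNge.
  by rewrite [in ltRHS](splitr t) EFinD lteD //; exact: le_lt_trans ht.
rewrite leNgt; apply/negP => /= ht; move: tI; apply/negP; rewrite -ltNge.
by rewrite [in ltRHS](splitr t) EFinD lteD //; exact: lt_trans ht.
Qed.

Definition bisection (a b : R) k : R * R := iter k heavy_half (a, b).

Variables a b : R.
Hypothesis ab : a < b.
Local Notation I := (bisection a b).

Lemma bisection_size k : (I k).2 - (I k).1 = (b - a) / 2 ^+ k.
Proof.
elim: k => [|k IH]; first by rewrite /= divr1.
have -> : (b - a) / 2 ^+ k.+1 = ((b - a) / 2 ^+ k) / 2.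
  by rewrite exprSr invfM mulrA.
rewrite -IH /= /heavy_half; case: ifP => _ /=; lra.
Qed.

Lemma bisection_le k : (I k).1 <= (I k).2.
Proof. by rewrite -subr_ge0 bisection_size divr_ge0 ?exprn_ge0 // subr_ge0 ltW. Qed.

Lemma bisection_homo j k : (j <= k)%N ->
  (I j).1 <= (I k).1 /\ (I k).2 <= (I j).2.
Proof.
move=> /subnK <-; elim: (k - j)%N => [|d [IHl IHr]]; first by rewrite add0n.
move: (bisection_le (d + j)); rewrite addSn [I (d + j).+1]/= -/(I (d + j)) /heavy_half.
by case: ifP => _ /= dj; split; lra.
Qed.

Lemma bisection_measure t k : (t%:E <= mu `[a, b]%classic)%E ->
  ((t / 2 ^+ k)%:E <= mu `[(I k).1, (I k).2]%classic)%E.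
Proof.
move=> tab; elim: k => [|k IH]; first by rewrite divr1.
rewrite exprSr invfM mulrA; apply: heavy_half_measure => //; exact: bisection_le.
Qed.

(** By nestedness every left endpoint lies below every right endpoint, so the supremum of the left
    endpoints belongs to all the intervals. *)
Lemma bisection_point : exists z, forall k, (I k).1 <= z <= (I k).2.
Proof.
have lr j k : (I j).1 <= (I k).2.
  have [jk|/ltnW kj] := leqP j k.
    exact: le_trans (bisection_homo _ _ jk).1 (bisection_le k).
  exact: le_trans (bisection_le j) (bisection_homo _ _ kj).2.
exists (sup (range (fun k => (I k).1))) => k; apply/andP; split.
  apply: ub_le_sup; last by exists k.
  by exists (I 0%N).2 => _ [j _ <-].
apply: ge_sup; first by exists (I 0%N).1, 0%N.
by move=> _ [j _ <-].
Qed.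

Lemma singular_point : (0 < mu `[a, b]%classic)%E ->
  exists z, [/\ a <= z <= b,
    (forall e : R, 0 < e -> (0 < mu `](z - e)%R, (z + e)%R[%classic)%E) &
    (\int[mu]_(y in [set: R]) Tkernel z y = +oo)%E].
Proof.
move=> mu_gt0.
(* The mass of [[a, b]] may be infinite, so a finite positive lower bound [t] is halved instead. *)
have [t t0 tab] : exists2 t : R, 0 < t & (t%:E <= mu `[a, b]%classic)%E.
  move: mu_gt0; case: (mu _) => [r|_|//]; last by exists 1; rewrite ?leey.
  by rewrite lte_fin => r0; exists r.
have [z Iz] := bisection_point.
have tI k := bisection_measure t k tab.
have tk k : 0 < t / 2 ^+ k by rewrite divr_gt0 // exprn_gt0.
have pow_gt (M : R) : exists k : nat, M < 2 ^+ k.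
  exists (Num.truncn `|M|).+1; apply: le_lt_trans (ler_norm M) _.
  apply: lt_trans (truncnS_gt _) _.
  by rewrite -natrX ltr_nat ltn_expl.
exists z; split; first exact: (Iz 0%N).
- move=> e e0; have [k] := pow_gt ((b - a) / e).
  rewrite ltr_pdivrMr // => ke.
  have size_lt : (I k).2 - (I k).1 < e.
    by rewrite bisection_size ltr_pdivrMr ?exprn_gt0 // mulrC.
  apply: (@lt_le_trans _ _ (mu `[(I k).1, (I k).2]%classic)).
    by apply: lt_le_trans (tI k); rewrite lte_fin.
  apply: le_measure; rewrite ?inE // => y; rewrite /= !in_itv /=.
  by have := Iz k => /andP[? ?] /andP[? ?]; apply/andP; split; lra.
- apply/eqyP => A _; set g := integral _ _ _.
  have L0 : 0 < b - a by rewrite subr_gt0.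
  (* The lower bound for the integral over [I k] is [2 ^+ k * (t / (b - a) ^+ 2)]; this [k] makes it
     exceed [A]. *)
  have [k kA] := pow_gt (A / (t / (b - a) ^+ 2)).
  have {}kA : A <= (((b - a) / 2 ^+ k) ^- 2) * (t / 2 ^+ k).
    suff -> : ((b - a) / 2 ^+ k) ^- 2 * (t / 2 ^+ k) = 2 ^+ k * (t / (b - a) ^+ 2).
      by rewrite -ler_pdivrMr ?ltW // divr_gt0 // exprn_gt0.
    by field; rewrite subr_eq0 gt_eqF // expf_neq0.
  (* Both [z] and [y] lie in [I k], so the kernel there is at least the inverse square of its
     length. *)
  apply: (@le_trans _ _ (\int[mu]_(y in `[(I k).1, (I k).2])
    (cst (((b - a) / 2 ^+ k) ^- 2)%:E y))%E).
    rewrite integral_cst //.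
    apply: (@le_trans _ _ (((b - a) / 2 ^+ k) ^- 2 * (t / 2 ^+ k))%:E).
      by rewrite lee_fin.
    by rewrite EFinM lee_pmul // lee_fin ?invr_ge0 ?sqr_ge0 // ltW.
  apply: (@le_trans _ _ (\int[mu]_(y in `[(I k).1, (I k).2]) Tkernel z y)%E).
    apply: ge0_le_integral => //.
    - by move=> y _; rewrite lee_fin invr_ge0 sqr_ge0.
    - exact: (measurable_funS measurableT (@subsetT _ _) (measurable_Tkernel z)).
    - move=> y; rewrite /= in_itv /= => /andP[ly yr].
      have := Iz k => /andP[lz zr].
      rewrite /Tkernel; case: eqVneq => [_|yz]; first by rewrite leey.
      have zy0 : 0 < (z - y) ^+ 2 by rewrite exprn_even_gt0 //= subr_eq0 eq_sym.
      have Lk0 : 0 < ((b - a) / 2 ^+ k) ^+ 2.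
        by rewrite exprn_gt0 // divr_gt0 // exprn_gt0.
      rewrite lee_fin lef_pV2 ?posrE //.
      rewrite -bisection_size -[leLHS]real_normK ?num_real //.
      rewrite ler_pXn2r ?nnegrE ?subr_ge0 ?bisection_le // ler_norml.
      by apply/andP; split; lra.
  apply: ge0_subset_integral => //; first exact: measurable_Tkernel.
  by move=> y _; exact: Tkernel_ge0.
Qed.

End Bisection.

(** * Reduction of matrix integrability to the canonical basis *)

Section MatrixIntegral.
Context {R : realType} {n : nat}.
Variable Om : set R -> 'M[R[i]]_n.
Hypothesis Om_measure : matrix_measure Om.
Local Open Scope ereal_scope.
Local Notation e_ i := (delta_mx i 0%R : 'cV[R[i]]_n).

Import HBNNSimple.

(** [qmeasure] is a bare set function, known to agree with a measure on measurable sets only. This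
    suffices, as the integral evaluates it only at level sets of simple functions. *)
Lemma eq_integral_measurable_sets (m1 m2 : set R -> \bar R) (f : R -> \bar R) :
  (forall X, measurable X -> m1 X = m2 X) ->
  \int[m1]_(y in [set: R]) f y = \int[m2]_(y in [set: R]) f y.
Proof.
move=> m12; rewrite /integral.
by congr (ereal_sup _ - ereal_sup _); apply: eq_imagel => h _;
  apply: eq_fsbigr => r _; rewrite m12.
Qed.

Lemma qmeasureZ_le (a : R[i]) c X : measurable X ->
  qmeasure Om (a *: c) X <= ((complex.Re `|a|) ^+ 2)%:E * qmeasure Om c X.
Proof.
move=> mX; apply: ge_ereal_sup => _ [k _ <-].
rewrite -/(reqform _ _) reqformZ EFinM lee_wpmul2l ?lee_fin ?sqr_ge0 //.
by apply: ereal_sup_ubound; exists k.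
Qed.

Lemma qmeasureD_le u v X : measurable X ->
  qmeasure Om (u + v) X <= 2%:E * (qmeasure Om u X + qmeasure Om v X).
Proof.
move=> mX; apply: ge_ereal_sup => _ [k _ <-].
have [Om_psd _ _] := Om_measure.
set Y := X `&` _.
have psdY : psd (Om Y).
  apply: Om_psd; first exact: measurableI.
  by apply: bounded_setS (bounded_itv k%:R%R); exact: subIsetr.
apply: (@le_trans _ _ (2 * (reqform (Om Y) u + reqform (Om Y) v))%:E).
  by rewrite lee_fin; exact: reqformD_le.
rewrite EFinM lee_wpmul2l ?lee_fin //.
by rewrite EFinD; apply: leeD; apply: ereal_sup_ubound; exists k.
Qed.

(** The vectors with finite integral are closed under sums and scalar multiples, so it is enough to
    test a basis. *)
Lemma mx_integral_finiteP (f : R -> \bar R) :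
  measurable_fun [set: R] f -> (forall y, 0 <= f y) ->
  mx_integral_finite Om f <->
  forall i, \int[qmeasure Om (e_ i)]_(y in [set: R]) f y < +oo.
Proof.
move=> mf f0; split=> [fin i|fin c]; first exact: fin.
have [mu muE] := choice (qmeasure_measure _ Om_measure).
pose J c := \int[mu c]_(y in [set: R]) f y.
have JE c' : \int[qmeasure Om c']_(y in [set: R]) f y = J c'.
  exact/eq_integral_measurable_sets/muE.
have JZ_le a c' : J (a *: c') <= ((complex.Re `|a|%R) ^+ 2)%:E * J c'.
  pose k := NngNum (sqr_ge0 (complex.Re `|a|%R)).
  rewrite -(ge0_integral_mscale _ _ k) //; apply: ge0_le_measure_integral => // X mX.
  by rewrite -(muE _ _ mX) /= /mscale -(muE _ _ mX); exact: qmeasureZ_le.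
have JZ a c' : J c' < +oo -> J (a *: c') < +oo.
  move=> Jc; apply: le_lt_trans (JZ_le a c') _.
  by rewrite lte_mul_pinfty // lee_fin sqr_ge0.
have JD u v : J u < +oo -> J v < +oo -> J (u + v)%R < +oo.
  move=> Ju Jv; pose k := NngNum (ler0n R 2).
  apply: (@le_lt_trans _ _
      (\int[mscale k (measure_add (mu u) (mu v))]_(y in [set: R]) f y)).
    apply: ge0_le_measure_integral => // X mX.
    rewrite [leRHS](_ : _ = 2%:E * (mu u X + mu v X)); last by rewrite -measure_addE.
    by rewrite -!(muE _ _ mX); exact: qmeasureD_le.
  rewrite ge0_integral_mscale // ge0_integral_measure_add //.
  by rewrite lte_mul_pinfty // ?adde_ge0 ?integral_ge0 // lte_add_pinfty.
rewrite JE [c]matrix_sum_delta.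
apply: (big_ind (fun c' => J c' < +oo)) => [||i _].
(* The bound is [0 * J c], which is [0] even if [J c] is infinite. *)
- by rewrite -(scale0r c) (le_lt_trans (JZ_le _ _)) // normr0 expr0n mul0e.
- exact: JD.
- by rewrite big_ord1 ord1; apply: JZ; rewrite -JE.
Qed.

End MatrixIntegral.

(** * The support in terms of the diagonal scalar measures *)

Section Support.
Context {R : realType} {n : nat}.
Variable Om : set R -> 'M[R[i]]_n.
Hypothesis Om_measure : matrix_measure Om.
Local Notation e_ i := (delta_mx i 0 : 'cV[R[i]]_n).

Lemma bounded_oo_itv (a b : R) : Defs.bounded_set `]a, b[.
Proof.
exists (Num.max `|a| `|b|) => x /=; rewrite !in_itv /= => /andP[ax xb].
have : `|a| <= Num.max `|a| `|b| by rewrite le_max lexx.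
have : `|b| <= Num.max `|a| `|b| by rewrite le_max lexx orbT.
rewrite !ler_norml => /andP[? ?] /andP[? ?]; apply/andP; split; lra.
Qed.

(** The diagonal entries are nonnegative, so none cancel in the trace; they are also real, so their
    real parts determine them. *)
Lemma psd_trace_eq0 (A : 'M[R[i]]_n) : psd A ->
  \tr A = 0 <-> forall i, reqform A (e_ i) = 0.
Proof.
move=> pA; have Aii i : 0 <= A i i by rewrite -qform_delta.
split=> [/eqP tr0 i|A0].
  move: tr0; rewrite /mxtrace psumr_eq0 // => /allP/(_ i).
  by rewrite mem_index_enum => /(_ isT)/eqP Ai; rewrite /reqform qform_delta Ai.
rewrite /mxtrace big1 // => i _; have := A0 i; rewrite /reqform qform_delta.
have := Aii i; rewrite lecE => /andP[/eqP Im0 _] Re0.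
by apply/eqP; rewrite eq_complex Re0 Im0 !eqxx.
Qed.

Lemma mx_suppP z : mx_supp Om z <-> forall e, 0 < e ->
  exists i, (0 < qmeasure Om (e_ i) `](z - e)%R, (z + e)%R[%classic)%E.
Proof.
have [Om_psd _ _] := Om_measure.
have pB e : psd (Om `]z - e, z + e[%classic).
  by apply: Om_psd => //; exact: bounded_oo_itv.
have qB e i : qmeasure Om (e_ i) `](z - e)%R, (z + e)%R[%classic =
    (reqform (Om `]z - e, z + e[%classic) (e_ i))%:E.
  by rewrite qmeasure_bounded //; exact: bounded_oo_itv.
split=> [suppz e e0|qz e e0].
  apply: contrapT => /forallNP noi; have /eqP := suppz _ e0; apply.
  apply/(psd_trace_eq0 _ (pB e)) => i; apply/eqP; rewrite eq_le reqform_ge0 // andbT.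
  by move/negP: (noi i); rewrite qB -leNgt lee_fin.
have [j] := qz _ e0; rewrite qB lte_fin => qj; apply/eqP.
by move=> /(psd_trace_eq0 _ (pB e)) /(_ j) qj0; rewrite qj0 ltxx in qj.
Qed.

End Support.

(** * Density and the representation by open sets *)

Theorem theorem3p9 (R : realType) (n : nat) (Om : set R -> 'M[R[i]]_n) :
  matrix_measure Om ->
  mx_integral_finite Om Pkernel ->
  let S := [set x | mx_supp Om x /\ ~ mx_integral_finite Om (Tkernel x)] in
  (* S is dense in supp Om (relative topology) *)
  mx_supp Om `<=` closure S /\
  (* S is a G_delta in supp Om (relative topology): supp Om intersected
     with a countable intersection of open subsets of R *)
  exists2 U : (set R)^nat, (forall k, open (U k)) &
    S = mx_supp Om `&` \bigcap_k U k.
Proof.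
move=> Om_measure _ S.
pose e_ i : 'cV[R[i]]_n := delta_mx i 0.
have [mu muE] := choice (qmeasure_measure _ Om_measure).
pose g i x := (\int[mu (e_ i)]_(y in [set: R]) Tkernel x y)%E.
have finP x : mx_integral_finite Om (Tkernel x) <-> forall i, (g i x < +oo)%E.
  rewrite (mx_integral_finiteP _ Om_measure _ (measurable_Tkernel x) (Tkernel_ge0 x)).
  split=> fin i; have := fin i; rewrite /g.
    by rewrite (eq_integral_measurable_sets _ _ _ (muE (e_ i))).
  by rewrite (eq_integral_measurable_sets _ _ _ (muE (e_ i))).
have g0 i x : (0 <= g i x)%E by apply: integral_ge0 => y _; exact: Tkernel_ge0.
split=> [x suppx B /nbhs_ballP[r /= r0 rB]|].
  (* Halving [r] keeps the closed interval used for bisection inside the ball. *)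
  have [j] := (mx_suppP _ Om_measure x).1 suppx (r / 2) (divr_gt0 r0 (ltr0n _ 2)).
  rewrite (muE _ _ (measurable_itv _)) => mu_gt0.
  have ab : x - r / 2 < x + r / 2 by lra.
  have {}mu_gt0 : (0 < mu (e_ j) `[(x - r / 2)%R, (x + r / 2)%R]%classic)%E.
    apply: (lt_le_trans mu_gt0); apply: le_measure; rewrite ?inE //.
    exact: subset_itv_oo_cc.
  have [z [/andP[lz zr] z_supp gz]] := singular_point _ _ _ ab mu_gt0.
  exists z; split; last first.
    by apply: rB; rewrite /ball /= ltr_distlC; apply/andP; split; lra.
  split; last by move=> /finP /(_ j); rewrite /g gz.
  apply/(mx_suppP _ Om_measure) => e e0; exists j.
  by rewrite (muE _ _ (measurable_itv _)); exact: z_supp.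
(* A point lies in all these open sets exactly when some [g i] is infinite there, because there are
   finitely many [i]. *)
exists (fun k => \bigcup_i [set x | (k%:R%:E < g i x)%E]).
  move=> k; apply: bigcup_open => i _.
  exact: ((lower_semicontinuousP _).1
    (lower_semicontinuous_integral_Tkernel (mu (e_ i)))).
apply/seteqP; split=> x [suppx]; rewrite ?finP => gx; split=> //.
  move=> k _; apply: contrapT => gk; apply: gx => i.
  rewrite ltNge; apply/negP => gi; apply: gk; exists i => //=.
  by apply: lt_le_trans gi; rewrite ltry.
(* If all [g i x] were finite, this sum would bound them simultaneously, whichever [i] is
   returned. *)
move=> fin; have [i _] := gx (\sum_i (Num.truncn (fine (g i x))).+1)%N I.
apply/negP; rewrite -leNgt -[leLHS]fineK; last first.
  by rewrite (ge0_fin_numE (g0 i x)); exact: (finP x).1.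
rewrite lee_fin; apply: le_trans (ltW (truncnS_gt _)) _.
by rewrite ler_nat (bigD1 i) //= leq_addr.
Qed.
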